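(* Let $u,v:\Omega\subset\mathbb{R}^n\to\mathbb{R}$, with $u_{x_n}>0$, satisfy the equations $$a(u)\Delta u+b(u)|\nabla u|^2=f(u),\qquad k(v)\Delta v+l(v)|\nabla v|^2=g(v),$$ and suppose that $u=\Phi(v)$ for some $\Phi:\mathbb{R}\to\mathbb{R}$ with $\Phi'\neq 0$, and that $p(t)\neq 0$ and $a(t)\neq 0$, where $$p(t):=k(t)\,a(\Phi(t))\,\Phi''(t)+k(t)\,b(\Phi(t))\,(\Phi'(t))^2-l(t)\,a(\Phi(t))\,\Phi'(t).$$ Then the vector field $F=(F_1,\dots,F_{n-1})$ defined by $F_i=\dfrac{u_{x_i}}{u_{x_n}}$, $i=1,\dots,n-1$, satisfies the Euler equations $$F_{x_n}+F\,\nabla_yF=0,\qquad y=(x_1,\dots,x_{n-1}).$$ Also, $\operatorname{div}_yF=0$ if and only if $\Phi$ is a solution of the ODE $$a(\Phi(t))\,\Phi'(t)\,G'(t)+2\left[b(\Phi(t))(\Phi'(t))^2+a(\Phi(t))\Phi''(t)\right]G(t)=2f(\Phi(t)),$$ where $$G(t):=\frac{k(t)f(\Phi(t))-g(t)\,a(\Phi(t))\,\Phi'(t)}{p(t)}.$$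
   Context: Here $n\ge 2$, and $a,b,f,k,l,g$ are real-valued functions of one real variable. Subscripts $x_i$ denote partial derivatives with respect to the $i$-th coordinate of $x=(x_1,\dots,x_n)$; $\nabla$ and $\Delta$ are the gradient and Laplacian in $\mathbb{R}^n$. The equation $F_{x_n}+F\,\nabla_yF=0$ means $(F_i)_{x_n}+\sum_{j=1}^{n-1}F_j(F_i)_{x_j}=0$ for $i=1,\dots,n-1$, and $\operatorname{div}_yF=\sum_{i=1}^{n-1}(F_i)_{x_i}$. The variable $x_n$ plays the role of time.
   Formalization: The ODE for Φ (with existence of G′) is required only for t in the range v(Ω), not for all real t, since the equations say nothing about the coefficients off the ranges of u and v; u, v are C² on an open Ω and Φ is twice differentiable. *)

(* Defs.v *)
From HB Require Import structures.
From mathcomp Require Import all_boot all_order all_algebra.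
From mathcomp Require Import all_classical all_reals all_analysis.

Set Implicit Arguments.
Unset Strict Implicit.
Unset Printing Implicit Defensive.
Import Order.TTheory GRing.Theory Num.Theory.
Import numFieldNormedType.Exports.

Local Open Scope ring_scope.
Local Open Scope classical_set_scope.

Section PartialDerivatives.
Context {R : realType} {n : nat}.
Implicit Types (f : 'rV[R]_n -> R) (x : 'rV[R]_n) (i : 'I_n).

Definition partial i f : 'rV[R]_n -> R :=
  fun x => 'D_(delta_mx 0 i) f x.

Definition partially_derivable i f x : Prop :=
  derivable f x (delta_mx 0 i).

(* The library norm on 'rV[R]_n is the sup norm, hence the explicit sum for
   the square of the Euclidean norm of the gradient. *)
Definition sqr_norm_grad f x : R := \sum_i (partial i f x) ^+ 2.

Definition laplacian f x : R := \sum_i partial i (partial i f) x.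

(* f is C^k on the open set O: all its partial derivatives of order at most k
   exist and are continuous at every point of O.  Functions are total on
   'rV[R]_n, but only their values on O matter when O is open. *)
Fixpoint Ck_on (k : nat) (O : set 'rV[R]_n) f : Prop :=
  (forall x, O x -> {for x, continuous f}) /\
  (if k is k'.+1 then
     forall i, (forall x, O x -> partially_derivable i f x) /\
               Ck_on k' O (partial i f)
   else True).

Definition solves_pde (O : set 'rV[R]_n) (a b f : R -> R) (u : 'rV[R]_n -> R) :
    Prop :=
  forall x, O x ->
    a (u x) * laplacian u x + b (u x) * sqr_norm_grad u x = f (u x).

End PartialDerivatives.

(* The ambient space is R^(m+1), that is n = m + 1.  The last coordinate
   (index ord_max) is the time x_n; the space variables y are x_1, ..., x_m,
   embedded among the coordinates of x by [y_idx]. *)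
Section EulerEquations.
Context {R : realType} {m : nat}.
Implicit Types (F : 'I_m -> 'rV[R]_m.+1 -> R).

Definition y_idx (i : 'I_m) : 'I_m.+1 := widen_ord (leqnSn m) i.

Definition time_idx : 'I_m.+1 := ord_max.

(* The existence of the partial derivatives of F is part of the claim, since
   [partial] has a default value where the derivative does not exist. *)
Definition solves_euler (O : set 'rV[R]_m.+1) F : Prop :=
  forall x, O x -> forall i : 'I_m,
    (forall j : 'I_m.+1, partially_derivable j (F i) x) /\
    partial time_idx (F i) x + \sum_j F j x * partial (y_idx j) (F i) x = 0.

Definition div_y F (x : 'rV[R]_m.+1) : R := \sum_i partial (y_idx i) (F i) x.

Definition slope_field (u : 'rV[R]_m.+1 -> R) : 'I_m -> 'rV[R]_m.+1 -> R :=
  fun i x => partial (y_idx i) u x / partial time_idx u x.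

End EulerEquations.

(* In ring_scope these notations otherwise denote the formal derivatives of a
   polynomial. *)
Local Notation "f ^` ()" := (derive1 f) : ring_scope.
Local Notation "f ^` ( n )" := (derive1n n f) : ring_scope.

Section ODE.
Context {R : realType}.
Implicit Types (a b f k l g Phi : R -> R).

Definition p_fun a b k l Phi (t : R) : R :=
  k t * a (Phi t) * Phi^`(2) t + k t * b (Phi t) * (Phi^`() t) ^+ 2
  - l t * a (Phi t) * Phi^`() t.

Definition G_fun a b f k l g Phi (t : R) : R :=
  (k t * f (Phi t) - g t * a (Phi t) * Phi^`() t) / p_fun a b k l Phi t.

(* Phi solves the ODE on the set I; as for the Euler equations, the
   derivative of G is required to exist. *)
Definition solves_ode (I : set R) a b f k l g Phi : Prop :=
  let G := G_fun a b f k l g Phi in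
  forall t, I t ->
    derivable G t 1 /\
    a (Phi t) * Phi^`() t * G^`() t
    + 2 * (b (Phi t) * (Phi^`() t) ^+ 2 + a (Phi t) * Phi^`(2) t) * G t
    = 2 * f (Phi t).

End ODE.

(* Main.v *)
(* Eliminating the Laplacian of v between the two equations gives the eikonal
   equation |grad v|^2 = G(v), and F_i = v_{x_i} / v_{x_n} since u = Phi(v).
   As v_{x_n} <> 0, v has a local inverse along the time axis, so G is
   differentiable on the range of v, and differentiating the eikonal equation
   gives 2 sum_j v_{x_j} v_{x_i x_j} = G'(v) v_{x_i}.  The two sides of the
   Euler equations then cancel, and div_y F = (Delta v - G'(v) / 2) / v_{x_n},
   which vanishes exactly when the ODE holds, by the equation for u. *)
Require Import Defs.
From mathcomp Require Import all_boot all_order all_algebra.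
From mathcomp Require Import all_classical all_reals all_analysis.
From mathcomp Require Import ring lra.

Set Implicit Arguments.
Unset Strict Implicit.
Unset Printing Implicit Defensive.
Import Order.TTheory GRing.Theory Num.Theory.
Import numFieldNormedType.Exports.
Local Open Scope ring_scope.
Local Open Scope classical_set_scope.

(** * Directional derivatives as derivatives along lines *)

Section DirectionalDerivatives.
Context {R : realType} {V : normedModType R}.
Implicit Types (f : V -> R) (x v : V).

(** Both difference quotients are the same function of [h]. One-variable results thus apply to
    directional derivatives. *)
Lemma is_derive_line f x v (t df : R) :
  is_derive (t *: v + x) v f df <->
  is_derive t 1 (fun s : R => f (s *: v + x)) df.
Proof.
have shiftE (h : R) : h *: v + (t *: v + x) = (h *: 1 + t) *: v + x.
  by rewrite addrA -scalerDl [h *: 1]mulr1.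
have D : derivable f (t *: v + x) v = derivable (fun s : R => f (s *: v + x)) t 1.
  rewrite /derivable; set g1 := fun h => h^-1 *: _; set g2 := fun h => h^-1 *: _.
  suff -> : g1 = g2 by [].
  by apply/funext => h; rewrite /g1 /g2 /= shiftE.
have E : 'D_v f (t *: v + x) = 'D_1 (fun s : R => f (s *: v + x)) t.
  rewrite /derive; set g1 := fun h => h^-1 *: _; set g2 := fun h => h^-1 *: _.
  suff -> : g1 = g2 by [].
  by apply/funext => h; rewrite /g1 /g2 /= shiftE.
by split=> -[d <-]; [split; rewrite -?D ?E|split; rewrite ?D ?E].
Qed.

Lemma is_derive_line0 f x v (df : R) :
  is_derive x v f df <-> is_derive (0 : R) 1 (fun s : R => f (s *: v + x)) df.
Proof.
by have := is_derive_line f x v 0 df; rewrite scale0r add0r.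
Qed.

(** Restricting to the line through [x] reduces this to the one-variable chain rule, so only the
    derivative of [f] along [v] enters. *)
Lemma is_derive_comp_line (g : R -> R) f x v (dg df : R) :
  is_derive (f x) 1 g dg -> is_derive x v f df ->
  is_derive x v (g \o f) (dg * df).
Proof.
move=> hg /is_derive_line0 hf; apply/is_derive_line0.
apply: is_derive1_comp => //; by rewrite scale0r add0r.
Qed.

Lemma is_derive_div f g x v (df dg : R) : g x != 0 ->
  is_derive x v f df -> is_derive x v g dg ->
  is_derive x v (fun y => f y / g y) ((df * g x - f x * dg) / g x ^+ 2).
Proof.
move=> g0 hf hg.
have hV : is_derive x v (GRing.inv \o g) (- g x ^- 2 * dg).
  apply: is_derive_comp_line => //.
  by apply: is_derive_eq; [exact: is_deriveV (is_derive_id _ _)|exact: mulr1].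
have H : is_derive x v (fun y => f y / g y) _ := is_deriveM hf hV.
apply: is_derive_eq H _.
by rewrite /GRing.scale /=; field.
Qed.

End DirectionalDerivatives.

(** * Mean value theorem and local inversion in one variable *)

Lemma MVT_is_derive (R : realType) (f df : R -> R) (a b : R) : a < b ->
  (forall x, a <= x <= b -> is_derive x (1 : R) f (df x)) ->
  exists2 c, a < c < b & f b - f a = df c * (b - a).
Proof.
move=> ab hf; have [||c] := @MVT R f df a b ab.
- by move=> x; rewrite in_itv /= => /andP[ax xb]; apply: hf; rewrite !ltW.
- apply: continuous_in_subspaceT => x; rewrite inE /= in_itv /= => /hf[d _].
  exact/differentiable_continuous/derivable1_diffP.
- by rewrite in_itv; exists c.
Qed.

(* h is inverted near x, so that G is locally the composite of q with the
   inverse of h. *)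
Lemma is_derive_factor (R : realType) (h dh q G : R -> R) (x dq : R) :
  (\forall s \near x, is_derive s (1 : R) h (dh s) /\ dh s != 0) ->
  is_derive x (1 : R) q dq -> (\forall s \near x, G (h s) = q s) ->
  is_derive (h x) (1 : R) G (dq / dh x).
Proof.
move=> dh_near hq Gh.
have [r /= r0 hr] : exists2 r, 0 < r & forall s, `|x - s| < r -> is_derive s (1 : R) h (dh s) /\ dh s != 0.
  by move/nbhs_ballP : dh_near => [r r0 H]; exists r.
have ch s : `|x - s| < r -> {for s, continuous h}.
  move=> /hr[[d _] _]; exact/differentiable_continuous/derivable1_diffP.
(* Equal values would force a zero of [dh] between [s] and [t] by the mean value theorem. *)
have inj s t : `|x - s| < r -> `|x - t| < r -> s < t -> h s != h t.
  move=> xs xt st.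
  have in_ball c : s <= c <= t -> `|x - c| < r.
    by move: xs xt; rewrite !ltr_norml => ? ? ?; lra.
  have [c /andP[sc ct] E] := @MVT_is_derive R h dh s t st
    (fun c hc => (hr c (in_ball c hc)).1).
  have [|_ dc0] := hr c; first by apply: in_ball; rewrite !ltW.
  by rewrite eq_sym -subr_eq0 E mulf_neq0// subr_eq0 gt_eqF.
(* Local inverse by choice: the preimage in the ball, unique by [inj], and the default [x] when
   there is none. *)
pose k y := xget x [set s | `|x - s| < r /\ h s = y].
have hk : {near x, cancel h k}.
  apply/nbhs_ballP; exists r => //= s xs.
  rewrite /k; case: xgetP => [t _ [xt ht]|/(_ s)]; last by case.
  case: (ltgtP s t) => [st|ts|//].
    by have := inj _ _ xs xt st; rewrite ht eqxx.
  by have := inj _ _ xt xs ts; rewrite ht eqxx.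
have hc : {near x, continuous h}.
  by apply/nbhs_ballP; exists r => //= s; exact: ch.
have [dx dx0] := hr x ltac:(by rewrite subrr normr0).
have dk := is_derive_inverse hk hc dx dx0.
have kx : k (h x) = x by exact: nbhs_singleton hk.
have dqk : is_derive (h x) (1 : R) (q \o k) (dq / dh x).
  by apply: is_derive1_comp; rewrite kx.
(* It remains to see that [G] and [q \o k] agree near [h x]: there [h (k y) = y], and [k y] is close
   to [x] by continuity of [k]. *)
apply: near_eq_is_derive dqk.
have ck : {for h x, continuous k}.
  by apply/differentiable_continuous/derivable1_diffP; case: dk.
have kh := near_continuous_can_sym hc hk.
have Gk : \forall y \near h x, G (h (k y)) = q (k y).
  have Gk' : \forall s \near k (h x), G (h s) = q s by rewrite kx.
  exact: ck Gk'.
by near=> y; rewrite /= -(near Gk y)// (near kh y).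
Unshelve. all: by end_near. Qed.

(** * Symmetry of mixed second derivatives *)

Section Schwarz.
Context {R : realType} {V : normedModType R}.
Implicit Types (f fe fd fed fde : V -> R) (x e d : V).

(** Two uses of the mean value theorem: along [e] for the difference [w] of [f] on two parallel
    segments, then along [d] for [fe]. *)
Lemma second_difference f fe fed x e d (eps : R) : 0 < eps ->
  (forall s t : R, 0 <= s <= eps -> 0 <= t <= eps ->
    let y := s *: e + (t *: d + x) in
    is_derive y e f (fe y) /\ is_derive y d fe (fed y)) ->
  exists s t, [/\ 0 <= s <= eps, 0 <= t <= eps &
    f (eps *: e + (eps *: d + x)) - f (eps *: e + x) - f (eps *: d + x) + f x
    = fed (s *: e + (t *: d + x)) * eps ^+ 2].
Proof.
move=> eps0 hf.
have eps_in : 0 <= eps <= eps by rewrite lexx ltW.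
have zero_in : 0 <= (0 : R) <= eps by rewrite lexx ltW.
pose w := (fun s : R => f (s *: e + (eps *: d + x))) -
          (fun s : R => f (s *: e + x)).
have [s s_in ws] : exists2 s, 0 < s < eps & w eps - w 0 =
    (fe (s *: e + (eps *: d + x)) - fe (s *: e + x)) * (eps - 0).
  apply: (@MVT_is_derive R w (fun s => fe (s *: e + (eps *: d + x)) - fe (s *: e + x))) => // s s_in.
  have d1 := (is_derive_line _ _ _ _ _).1 (hf s eps s_in eps_in).1.
  have := (hf s 0 s_in zero_in).1; rewrite scale0r add0r => /is_derive_line d0.
  exact: (is_deriveB d1 d0).
have {}s_in : 0 <= s <= eps by case/andP: s_in => ? ?; rewrite !ltW.
have [t t_in zt] : exists2 t, 0 < t < eps &
    fe (eps *: d + (s *: e + x)) - fe (0 *: d + (s *: e + x)) =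
    fed (t *: d + (s *: e + x)) * (eps - 0).
  apply: (@MVT_is_derive R (fun t => fe (t *: d + (s *: e + x)))
    (fun t => fed (t *: d + (s *: e + x)))) => // t t_in.
  by have := (hf s t s_in t_in).2; rewrite (addrCA (s *: e)) => /is_derive_line.
exists s, t; split => //; first by case/andP: t_in => ? ?; rewrite !ltW.
move: ws zt; rewrite /w !fctE !scale0r !add0r subr0 !(addrCA (s *: e)) => ws zt.
rewrite expr2 mulrA -zt -ws.
ring.
Qed.

(** The second difference is symmetric in [e] and [d], so [fed] at some point near [x] equals [fde]
    at another; continuity at [x] concludes. *)
Lemma schwarz f fe fd fed fde x e d :
  (\forall y \near x, [/\ is_derive y e f (fe y), is_derive y d f (fd y),
     is_derive y d fe (fed y) & is_derive y e fd (fde y)]) ->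
  {for x, continuous fed} -> {for x, continuous fde} -> fed x = fde x.
Proof.
move=> hd ced cde; apply/eqP; rewrite -subr_eq0 -normr_le0.
apply/ler_addgt0Pl => eta eta0; rewrite addr0.
have /nbhs_normP[r /= r0 hr] : \forall y \near x,
  [/\ [/\ is_derive y e f (fe y), is_derive y d f (fd y),
     is_derive y d fe (fed y) & is_derive y e fd (fde y)],
     `|fed x - fed y| < eta / 2 & `|fde x - fde y| < eta / 2].
  near=> y; split; first by near: y.
    by near: y; move/cvgr_dist_lt : ced; apply; rewrite divr_gt0.
  by near: y; move/cvgr_dist_lt : cde; apply; rewrite divr_gt0.
(* With [eps = r / N] the parallelogram spanned by [eps *: e] and [eps *: d] at [x] lies in the ball
   of radius [r]; the summand 1 makes [N] positive and the bound strict. *)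
pose N := 1 + `|e| + `|d|.
have N0 : 0 < N by rewrite /N -addrA ltr_pwDl// addr_ge0.
pose eps := r / N.
have eps0 : 0 < eps by rewrite divr_gt0.
have in_r s t : 0 <= s <= eps -> 0 <= t <= eps -> `|x - (s *: e + (t *: d + x))| < r.
  move=> /andP[s0 s1] /andP[t0 t1].
  have -> : x - (s *: e + (t *: d + x)) = - (s *: e + t *: d).
    by rewrite addrA opprD (addrC (- _)) addrA subrr add0r.
  rewrite normrN (le_lt_trans (ler_normD _ _))// !normrZ !ger0_norm//.
  have -> : r = eps * N by rewrite /eps divfK// gt_eqF.
  rewrite /N -addrA mulrDr mulr1 mulrDr ltr_pwDl// lerD// ler_wpM2r//.
have [s [t [s_in t_in E1]]] := @second_difference f fe fed x e d eps eps0
  (fun s t hs ht => let: And3 (And4 p _ q _) _ _ := hr _ (in_r s t hs ht) in conj p q).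
have in_r' s' t' : 0 <= s' <= eps -> 0 <= t' <= eps -> `|x - (s' *: d + (t' *: e + x))| < r.
  by move=> hs ht; rewrite (addrCA (s' *: d)); exact: in_r.
have [s' [t' [s'_in t'_in E2]]] := @second_difference f fd fde x d e eps eps0
  (fun s t hs ht => let: And3 (And4 _ p _ q) _ _ := hr _ (in_r' s t hs ht) in conj p q).
have E : fed (s *: e + (t *: d + x)) = fde (s' *: d + (t' *: e + x)).
  have e2 : eps ^+ 2 != 0 by rewrite expf_neq0// gt_eqF.
  apply: (mulIf e2); rewrite -E1 -E2 (addrCA (eps *: d)); ring.
have [_ + _] := hr _ (in_r s t s_in t_in).
have [_ _] := hr _ (in_r' s' t' s'_in t'_in).
rewrite E !ltr_norml ler_norml => ? ?; lra.
Unshelve. all: by end_near. Qed.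

End Schwarz.

(** * Partial derivatives of functions of class C^2 *)

Section SecondOrderPartials.
Context {R : realType} {n : nat}.
Variables (O : set 'rV[R]_n) (v : 'rV[R]_n -> R).
Hypotheses (openO : open O) (C2v : Ck_on 2 O v).

Lemma Ck2_is_derive x i : O x -> is_derive x (delta_mx 0 i) v (partial i v x).
Proof. by move=> Ox; apply: derivableP; exact: (C2v.2 i).1. Qed.

Lemma Ck2_is_derive2 x i j : O x ->
  is_derive x (delta_mx 0 j) (partial i v) (partial j (partial i v) x).
Proof. by move=> Ox; apply: derivableP; exact: ((C2v.2 i).2.2 j).1. Qed.

Lemma partialC x i j : O x ->
  partial j (partial i v) x = partial i (partial j v) x.
Proof.
move=> Ox.
apply: (@schwarz R _ v (partial i v) (partial j v) _ _ x (delta_mx 0 i) (delta_mx 0 j)).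
- have Onear := open_nbhs_nbhs (conj openO Ox).
  near=> y; have Oy : O y by near: y.
  by split; [exact: Ck2_is_derive|exact: Ck2_is_derive|exact: Ck2_is_derive2|
    exact: Ck2_is_derive2].
- exact: ((C2v.2 i).2.2 j).2.1.
- exact: ((C2v.2 j).2.2 i).2.1.
Unshelve. all: by end_near. Qed.

(** The product rule yields [partial i (partial j v)]; the order is exchanged to match the terms
    produced by differentiating the slopes. *)
Lemma is_derive_sqr_norm_grad x i : O x ->
  is_derive x (delta_mx 0 i) (sqr_norm_grad v)
    (2 * \sum_j partial j v x * partial j (partial i v) x).
Proof.
move=> Ox.
have hj j : is_derive x (delta_mx 0 i) (partial j v * partial j v)
    (2 * (partial j v x * partial j (partial i v) x)).
  have dj := Ck2_is_derive2 j i Ox.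
  apply: is_derive_eq (is_deriveM dj dj) _.
  by rewrite partialC// /GRing.scale /=; ring.
have := is_derive_sum hj; rewrite -mulr_sumr.
suff -> : \sum_j partial j v * partial j v = sqr_norm_grad v by [].
by apply/funext => y; rewrite fct_sumE; apply: eq_bigr => j _; rewrite expr2.
Qed.

End SecondOrderPartials.

(** * Locality of derivatives on an open set *)

Section Congruence.
Context {R : realType}.

Lemma eq_on_is_derive n (O : set 'rV[R]_n) (f g : 'rV[R]_n -> R) x e df :
  open O -> (forall y, O y -> f y = g y) -> O x ->
  is_derive x e f df -> is_derive x e g df.
Proof.
move=> openO fg Ox; apply: near_eq_is_derive.
have Onear := open_nbhs_nbhs (conj openO Ox).
by near=> y; apply: fg; near: y.
Unshelve. all: by end_near. Qed.

Lemma eq_on_partial n (O : set 'rV[R]_n) (f g : 'rV[R]_n -> R) x i :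
  open O -> (forall y, O y -> f y = g y) -> O x -> partial i f x = partial i g x.
Proof.
move=> openO fg Ox; apply: near_eq_derive.
have Onear := open_nbhs_nbhs (conj openO Ox).
by near=> y; apply: fg; near: y.
Unshelve. all: by end_near. Qed.

Lemma eq_on_solves_euler m (O : set 'rV[R]_m.+1) (F E : 'I_m -> 'rV[R]_m.+1 -> R) :
  open O -> (forall i y, O y -> F i y = E i y) ->
  solves_euler O F -> solves_euler O E.
Proof.
move=> openO FE eulF x Ox i; have [dF euF] := eulF x Ox i; split.
  move=> j; have /derivableP dFj := dF j.
  by have [] := eq_on_is_derive openO (FE i) Ox dFj.
rewrite -(eq_on_partial _ openO (FE i) Ox) -[RHS]euF; congr (_ + _).
by apply: eq_bigr => j _; rewrite -(eq_on_partial _ openO (FE i) Ox) FE.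
Qed.

End Congruence.

(** * Consequences of the eikonal equation *)

Section Eikonal.
Context {R : realType} {m : nat}.
Variables (O : set 'rV[R]_m.+1) (v : 'rV[R]_m.+1 -> R) (G : R -> R).
Hypotheses (openO : open O) (C2v : Ck_on 2 O v).
Hypothesis vt_neq0 : forall x, O x -> partial time_idx v x != 0.
Hypothesis eikonal : forall x, O x -> sqr_norm_grad v x = G (v x).

(** [G] is known only through its values at [v]. On the time line through [x], [is_derive_factor]
    applies with [h] the restriction of [v] and [q] that of its squared gradient norm. *)
Lemma eikonal_derivable x : O x -> derivable G (v x) 1.
Proof.
move=> Ox; pose e : 'rV[R]_m.+1 := delta_mx 0 time_idx.
have cl : {for (0 : R), continuous (fun s : R => s *: e + x)}.
  apply: cvgD; last exact: cvg_cst.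
  by apply: cvgZr_tmp; exact: cvg_id.
have Onear : \forall s \near (0 : R), O (s *: e + x).
  by apply: cl; rewrite scale0r add0r; exact: open_nbhs_nbhs.
have dv_near : \forall s \near (0 : R),
    is_derive s (1 : R) (fun s => v (s *: e + x)) (partial time_idx v (s *: e + x)) /\
    partial time_idx v (s *: e + x) != 0.
  near=> s; have Os : O (s *: e + x) by near: s.
  split; last exact: vt_neq0.
  exact: (is_derive_line _ _ _ _ _).1 (Ck2_is_derive C2v time_idx Os).
have dq := (is_derive_line0 _ _ _ _).1 (is_derive_sqr_norm_grad openO C2v time_idx Ox).
have Gv : \forall s \near (0 : R), G (v (s *: e + x)) = sqr_norm_grad v (s *: e + x).
  by near=> s; rewrite eikonal//; near: s.
by have [+ _] := is_derive_factor dv_near dq Gv; rewrite /= scale0r add0r.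
Unshelve. all: by end_near. Qed.

(** Both sides are the [i]-th partial derivative at [x] of the two members of the eikonal
    equation. *)
Lemma eikonal_grad x i : O x ->
  2 * \sum_j partial j v x * partial j (partial i v) x =
  derive1 G (v x) * partial i v x.
Proof.
move=> Ox; have [_ <-] := is_derive_sqr_norm_grad openO C2v i Ox.
have dG : is_derive (v x) (1 : R) G (derive1 G (v x)).
  by rewrite derive1E; apply: derivableP; exact: eikonal_derivable.
have [_ <-] := is_derive_comp_line dG (Ck2_is_derive C2v i Ox).
by apply: (eq_on_partial i openO _ Ox) => y /eikonal.
Qed.

(** Extends the slope field to the time index, where it equals 1 on [O], so that time and space
    terms fit in one sum over all coordinates. *)
Let slope i x := partial i v x / partial time_idx v x.

Lemma is_derive_slope x i j : O x ->
  is_derive x (delta_mx 0 j) (slope i)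
    ((partial j (partial i v) x * partial time_idx v x -
      partial i v x * partial j (partial time_idx v) x)
     / partial time_idx v x ^+ 2).
Proof.
move=> Ox; apply: is_derive_div; first exact: vt_neq0.
- exact: Ck2_is_derive2 Ox.
- exact: Ck2_is_derive2 Ox.
Qed.

Lemma partial_slope x i j : O x ->
  partial j (slope i) x =
  (partial j (partial i v) x * partial time_idx v x -
   partial i v x * partial j (partial time_idx v) x)
  / partial time_idx v x ^+ 2.
Proof. by case/(is_derive_slope i j). Qed.

Lemma eikonal_euler : solves_euler O (slope_field v).
Proof.
move=> x Ox i; split.
  by move=> j; have [] := is_derive_slope (y_idx i) j Ox.
have vt0 := vt_neq0 Ox.
transitivity (\sum_j slope j x * partial j (slope (y_idx i)) x).
  by rewrite big_ord_recr /= addrC /slope divff// mul1r.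
under eq_bigr do rewrite partial_slope//.
have gi := eikonal_grad (y_idx i) Ox; have gt := eikonal_grad time_idx Ox.
set c := partial time_idx v x in vt0 gt *.
set Si := \sum_j _ in gi; set St := \sum_j _ in gt.
(* By [eikonal_grad], [Si] and [St] are the same multiple of [partial (y_idx i) v x] and of [c], so
   the numerator vanishes. *)
transitivity ((c * Si - partial (y_idx i) v x * St) / c ^+ 3).
  have termE (p q h k : R) : p / c * ((h * c - q * k) / c ^+ 2) =
      (c * (p * h) - q * (p * k)) / c ^+ 3 by field.
  rewrite (eq_bigr _ (fun j _ => termE _ _ _ _)) -mulr_suml sumrB.
  by congr ((_ - _) / _); rewrite mulr_sumr.
have -> : Si = derive1 G (v x) * partial (y_idx i) v x / 2 by rewrite -gi; field.
have -> : St = derive1 G (v x) * c / 2 by rewrite -gt; field.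
by field.
Qed.

Lemma eikonal_div x : O x ->
  div_y (slope_field v) x =
  (laplacian v x - derive1 G (v x) / 2) / partial time_idx v x.
Proof.
move=> Ox; have vt0 := vt_neq0 Ox.
transitivity (\sum_i partial i (slope i) x).
  (* The added time term is zero: the numerator of the derivative of the time slope cancels. *)
  rewrite big_ord_recr /= [X in _ = _ + X]partial_slope//.
  by rewrite [X in X - _]mulrC subrr mul0r addr0.
under eq_bigr do rewrite partial_slope//.
have gt := eikonal_grad time_idx Ox.
set c := partial time_idx v x in vt0 gt *.
set St := \sum_j _ in gt.
transitivity ((laplacian v x * c - St) / c ^+ 2).
  by rewrite /laplacian /St !mulr_suml -sumrB mulr_suml.
have -> : St = derive1 G (v x) * c / 2 by rewrite -gt; field.
by field.
Qed.

End Eikonal.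

(** * Gradient and Laplacian of u = Phi(v) *)

Section ChangeOfUnknown.
Context {R : realType} {n : nat}.
Variables (O : set 'rV[R]_n) (u v : 'rV[R]_n -> R) (Phi : R -> R).
Hypotheses (openO : open O) (C2v : Ck_on 2 O v).
Hypothesis dPhi : forall t, derivable Phi t 1.
Hypothesis ddPhi : forall t, derivable (derive1 Phi) t 1.
Hypothesis uv : forall x, O x -> u x = Phi (v x).

Lemma partial_comp x i : O x ->
  partial i u x = derive1 Phi (v x) * partial i v x.
Proof.
move=> Ox; rewrite (eq_on_partial i openO uv Ox).
have dP : is_derive (v x) (1 : R) Phi (derive1 Phi (v x)).
  by rewrite derive1E; exact: derivableP.
by have [_ <-] := is_derive_comp_line dP (Ck2_is_derive C2v i Ox).
Qed.

Lemma partial2_comp x i : O x ->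
  partial i (partial i u) x =
  derive1n 2 Phi (v x) * partial i v x ^+ 2 +
  derive1 Phi (v x) * partial i (partial i v) x.
Proof.
move=> Ox.
rewrite (eq_on_partial i openO (fun y Oy => partial_comp i Oy) Ox).
have dP : is_derive (v x) (1 : R) (derive1 Phi) (derive1n 2 Phi (v x)).
  by rewrite /derive1n /= derive1E; exact: derivableP.
have dPv := is_derive_comp_line dP (Ck2_is_derive C2v i Ox).
have dv := Ck2_is_derive2 C2v i i Ox.
have [_ E] := is_deriveM dPv dv.
(* The pointwise product is convertible to the product of functions that [is_deriveM] handles. *)
transitivity ('D_(delta_mx 0 i) ((derive1 Phi \o v) * partial i v) x); first by [].
by rewrite E /GRing.scale /=; ring.
Qed.

Lemma sqr_norm_grad_comp x : O x ->
  sqr_norm_grad u x = derive1 Phi (v x) ^+ 2 * sqr_norm_grad v x.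
Proof.
move=> Ox; rewrite /sqr_norm_grad mulr_sumr; apply: eq_bigr => i _.
by rewrite partial_comp// exprMn.
Qed.

Lemma laplacian_comp x : O x ->
  laplacian u x = derive1n 2 Phi (v x) * sqr_norm_grad v x +
                  derive1 Phi (v x) * laplacian v x.
Proof.
move=> Ox; rewrite /laplacian /sqr_norm_grad !mulr_sumr -big_split.
by apply: eq_bigr => i _; rewrite partial2_comp.
Qed.

End ChangeOfUnknown.

(** * Euler equations and the divergence criterion *)

Theorem theorem2p3 (R : realType) (m : nat) (hm : (2 <= m.+1)%N)
  (Omega : set 'rV[R]_m.+1) (hOmega : open Omega)
  (u v : 'rV[R]_m.+1 -> R) (hu : Ck_on 2 Omega u) (hv : Ck_on 2 Omega v)
  (a b f k l g : R -> R)
  (hut : forall x, Omega x -> 0 < partial time_idx u x)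
  (hpdeu : solves_pde Omega a b f u)
  (hpdev : solves_pde Omega k l g v)
  (Phi : R -> R)
  (hPhi1 : forall t : R, derivable Phi t 1)
  (hPhi2 : forall t : R, derivable Phi^`() t 1)
  (huv : forall x, Omega x -> u x = Phi (v x))
  (hPhi' : forall t : R, Phi^`() t != 0)
  (hp : forall t, p_fun a b k l Phi t != 0)
  (ha : forall t, a t != 0) :
  solves_euler Omega (slope_field u) /\
  ((forall x, Omega x -> div_y (slope_field u) x = 0) <->
   solves_ode (v @` Omega) a b f k l g Phi).
Proof.
have vt0 x : Omega x -> partial time_idx v x != 0.
  move=> Ox; apply/eqP => vt0; have := hut x Ox.
  by rewrite (partial_comp hOmega hv hPhi1 huv time_idx Ox) vt0 mulr0 ltxx.
pose G := G_fun a b f k l g Phi.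
have pdeu x : Omega x ->
    a (Phi (v x)) * (derive1n 2 Phi (v x) * sqr_norm_grad v x +
      derive1 Phi (v x) * laplacian v x) +
    b (Phi (v x)) * (derive1 Phi (v x) ^+ 2 * sqr_norm_grad v x) = f (Phi (v x)).
  move=> Ox; rewrite -(sqr_norm_grad_comp hOmega hv hPhi1 huv Ox).
  by rewrite -(laplacian_comp hOmega hv hPhi1 hPhi2 huv Ox) -huv//; exact: hpdeu.
(* Take [k] times the equation for [u] minus [a(Phi) Phi'] times the one for [v]: the Laplacians
   cancel and the squared gradient norm is left with coefficient [p_fun]. *)
have eik x : Omega x -> sqr_norm_grad v x = G (v x).
  move=> Ox; apply: (mulIf (hp (v x))); rewrite /G /G_fun divfK//.
  by rewrite -(pdeu x Ox) -(hpdev x Ox) /p_fun; ring.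
have slopeE i x : Omega x -> slope_field v i x = slope_field u i x.
  move=> Ox; rewrite /slope_field !(partial_comp hOmega hv hPhi1 huv _ Ox).
  by rewrite -mulf_div divff ?mul1r// hPhi'.
have divE x : Omega x -> div_y (slope_field u) x =
    (laplacian v x - derive1 G (v x) / 2) / partial time_idx v x.
  move=> Ox; rewrite -(eikonal_div hOmega hv vt0 eik Ox).
  by apply: eq_bigr => i _; rewrite (eq_on_partial _ hOmega (slopeE i) Ox).
(* Substituting the equation for [u] for [f] and the eikonal equation for [G], the terms in the
   squared gradient norm cancel; the defect of the ODE is a multiple of the numerator in [divE]. *)
have odeE x : Omega x ->
    a (Phi (v x)) * derive1 Phi (v x) * derive1 G (v x) +
    2 * (b (Phi (v x)) * derive1 Phi (v x) ^+ 2
         + a (Phi (v x)) * derive1n 2 Phi (v x)) * G (v x) - 2 * f (Phi (v x)) =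
    2 * a (Phi (v x)) * derive1 Phi (v x) * (derive1 G (v x) / 2 - laplacian v x).
  by move=> Ox; rewrite -(pdeu x Ox) -(eik x Ox); field.
split.
  exact: eq_on_solves_euler hOmega slopeE (eikonal_euler hOmega hv vt0 eik).
split=> [div0|ode x Ox].
  rewrite /solves_ode -/G => _ [x Ox <-].
  split; first exact: (eikonal_derivable hOmega hv vt0 eik Ox).
  apply/eqP; rewrite -subr_eq0 odeE// mulf_eq0; apply/orP; right.
  have /eqP := div0 x Ox; rewrite divE// mulf_eq0 invr_eq0 (negbTE (vt0 x Ox)) orbF.
  by rewrite -opprB oppr_eq0.
(* Conversely, the factor [2 a(Phi) Phi'] in [odeE] is nonzero and can be divided out. *)
have [_ /eqP] := ode (v x) (imageP v Ox).
rewrite -subr_eq0 odeE// !mulf_eq0 pnatr_eq0 (negbTE (ha _)) (negbTE (hPhi' _)) /=.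
by rewrite divE// -opprB oppr_eq0 => /eqP ->; rewrite mul0r.
Qed.
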